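(* Let $V$ be a finite-dimensional vector space over a field $F$, let $\lambda\in F$, and let $\{\!\{\cdot,\cdot\}\!\}$ be a double bracket on $V$ determined by a linear operator $R\colon \mathrm{End}(V)\to\mathrm{End}(V)$ via $$\{\!\{a,b\}\!\}=\sum_{i=1}^{N}e_i(a)\otimes R(e_i^* )(b),\qquad a,b\in V,$$ where $e_1,\dots,e_N$ is a linear basis of $\mathrm{End}(V)$ and $e_1^*,\dots,e_N^*$ is the dual basis with respect to the trace form $(x,y)\mapsto\mathrm{tr}(xy)$. Then $V$ is a $\lambda$-double Lie algebra if and only if $R$ is a $\lambda$-skew-symmetric Rota--Baxter operator of weight $\lambda$ on $\mathrm{End}(V)$.
   Context: A double bracket on a vector space $V$ is a linear map $V\otimes V\to V\otimes V$, $a\otimes b\mapsto\{\!\{a,b\}\!\}$. For finite-dimensional $V$ every double bracket is given by a unique $R$ through the displayed formula, and the formula does not depend on the choice of basis. For $u\in V^{\otimes n}$ and $\sigma\in S_n$, $u^\sigma$ denotes $u$ with tensor factors permuted by $\sigma$ (so $(x\otimes y)^{(12)}=y\otimes x$, $(x\otimes y\otimes z)^{(12)}=y\otimes x\otimes z$, $(x\otimes y\otimes z)^{(23)}=x\otimes z\otimes y$). Put, extended linearly, $\{\!\{a,b\otimes c\}\!\}_L=\{\!\{a,b\}\!\}\otimes c$, $\{\!\{a,b\otimes c\}\!\}_R=b\otimes\{\!\{a,c\}\!\}$, $\{\!\{a\otimes b,c\}\!\}_L=(\{\!\{a,c\}\!\}\otimes b)^{(23)}$. A $\lambda$-double Lie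 algebra is a vector space $V$ with a double bracket such that for all $a,b,c\in V$: $$\{\!\{a,b\}\!\}+\{\!\{b,a\}\!\}^{(12)}=\lambda(a\otimes b-b\otimes a),$$ $$\{\!\{a,\{\!\{b,c\}\!\}\}\!\}_L-\{\!\{b,\{\!\{a,c\}\!\}\}\!\}_R-\{\!\{\{\!\{a,b\}\!\},c\}\!\}_L=-\lambda(b\otimes\{\!\{a,c\}\!\})^{(12)}.$$ A Rota--Baxter operator of weight $\lambda$ on an algebra $A$ is a linear map $R\colon A\to A$ with $R(x)R(y)=R(R(x)y+xR(y)+\lambda xy)$ for all $x,y\in A$. A linear operator $R$ on $\mathrm{End}(V)$ is $\lambda$-skew-symmetric if $R(x)+R^*(x)+\lambda x=\lambda\,\mathrm{tr}(x)\,\mathrm{id}_V$ for all $x\in\mathrm{End}(V)$, where $R^*$ is the adjoint of $R$ with respect to the trace form: $\mathrm{tr}(R(x)y)=\mathrm{tr}(xR^*(y))$. *)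

(* Defs.v *)
From HB Require Import structures.
From mathcomp Require Import all_boot all_order all_algebra.

Set Implicit Arguments.
Unset Strict Implicit.
Unset Printing Implicit Defensive.

Import GRing.Theory.
Local Open Scope ring_scope.

Section TensorProduct.
Variables (F : fieldType) (U W : vectType F).

(* The tensor product is realized as the linear maps from the dual of U to W, *)
(* x ⊗ y being f |-> f(x) y.  Lemmas [tens_bilinear], [tlift_linear],         *)
(* [tliftE] and [tlift_unique] are its universal property.                    *)
Definition tensor : vectType F := 'Hom('Hom(U, F^o), W).

Definition tens (x : U) (y : W) : tensor :=
  linfun (fun f : 'Hom(U, F^o) => (f x : F) *: y).

Definition vcoord (i : 'I_(\dim {:U})) : 'Hom(U, F^o) :=
  linfun (coord (vbasis {:U}) i : U -> F^o).

(* The linear extension of a bilinear f: if (u_i) is a basis of U and (u'_i)  *)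
(* its dual basis, then t is the sum of the u_i ⊗ t(u'_i), see [tensor_sum].  *)
Definition tlift (X : lmodType F) (f : U -> W -> X) (t : tensor) : X :=
  \sum_(i < \dim {:U}) f (vbasis {:U})`_i (t (vcoord i)).

Lemma tensE x y (f : 'Hom(U, F^o)) : tens x y f = (f x : F) *: y.
Proof.
pose g (f : 'Hom(U, F^o)) : W := (f x : F) *: y.
have g_lin : linear g by move=> a u v; rewrite /g !lfunE /= scalerDl scalerA lfunE.
pose gM := GRing.isLinear.Build F _ _ _ g g_lin.
pose gL : {linear _ -> _} := HB.pack g gM.
by rewrite /tens (lfunE gL).
Qed.

Lemma vcoordE i x : vcoord i x = coord (vbasis {:U}) i x.
Proof. by rewrite lfunE. Qed.

Lemma tens_bilinear : bilinear_for *:%R *:%R tens.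
Proof.
split=> [y|x] a u v; apply/lfunP=> f; rewrite !lfunE /= !lfunE /= !tensE.
  by rewrite linearP /= scalerDl scalerA.
by rewrite scalerDr !scalerA mulrC.
Qed.

Lemma tensor_sum (t : tensor) :
  t = \sum_(i < \dim {:U}) tens (vbasis {:U})`_i (t (vcoord i)).
Proof.
apply/lfunP=> f; rewrite sum_lfunE.
have {1}-> : f = \sum_(i < \dim {:U}) (f (vbasis {:U})`_i : F) *: vcoord i.
  apply/lfunP=> x; rewrite sum_lfunE [x in LHS](coord_vbasis (memvf x)) linear_sum.
  by apply: eq_bigr => i _; rewrite linearZ scale_lfunE vcoordE; apply: mulrC.
rewrite linear_sum; apply: eq_bigr => i _.
by rewrite linearZ /= tensE.
Qed.

Lemma tlift_linear (X : lmodType F) (f : U -> W -> X) :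
  bilinear_for *:%R *:%R f -> linear (tlift f).
Proof.
case=> _ fr a t t'; rewrite /tlift scaler_sumr -big_split /=.
by apply: eq_bigr => i _; rewrite !lfunE /= lfunE fr.
Qed.

Lemma tliftE (X : lmodType F) (f : U -> W -> X) x y :
  bilinear_for *:%R *:%R f -> tlift f (tens x y) = f x y.
Proof.
case=> fl fr; rewrite /tlift.
pose gM := GRing.isLinear.Build F _ _ _ (applyr f y) (fl y).
pose g : {linear U -> X} := HB.pack (applyr f y) gM.
rewrite [x in RHS](coord_vbasis (memvf x)) -[RHS]/(g _) linear_sum.
apply: eq_bigr => i _; rewrite linearZ /= tensE vcoordE.
pose hM := GRing.isLinear.Build F _ _ _ (f (vbasis {:U})`_i) (fr _).
pose h : {linear W -> X} := HB.pack (f (vbasis {:U})`_i) hM.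
by rewrite -[LHS]/(h _) linearZ.
Qed.

Lemma tlift_unique (X : lmodType F) (g h : {linear tensor -> X}) :
  (forall x y, g (tens x y) = h (tens x y)) -> g =1 h.
Proof.
move=> gh t; rewrite [t]tensor_sum !linear_sum.
by apply: eq_bigr => i _; apply: gh.
Qed.

End TensorProduct.

Section BilinearMaps.
Variables (F : fieldType) (U W X Y : vectType F).

Lemma bilinear_comp (f : U -> W -> X) (g : X -> Y) :
  bilinear_for *:%R *:%R f -> linear g ->
  bilinear_for *:%R *:%R (fun x y => g (f x y)).
Proof. by case=> fl fr gl; split=> [y|x] a u v /=; rewrite ?fl ?fr gl. Qed.

Lemma bilinear_compl (f : U -> W -> X) (g : Y -> U) :
  bilinear_for *:%R *:%R f -> linear g ->
  bilinear_for *:%R *:%R (fun x y => f (g x) y).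
Proof.
case=> fl fr gl; split=> [y|x] a u v /=; last exact: fr.
by rewrite gl; apply: fl.
Qed.

Lemma bilinear_compr (f : U -> W -> X) (g : Y -> W) :
  bilinear_for *:%R *:%R f -> linear g ->
  bilinear_for *:%R *:%R (fun x y => f x (g y)).
Proof.
case=> fl fr gl; split=> [y|x] a u v /=; first exact: fl.
by rewrite gl; apply: fr.
Qed.

Lemma bilinear_flip (f : U -> W -> X) :
  bilinear_for *:%R *:%R f -> bilinear_for *:%R *:%R (fun y x => f x y).
Proof. by case=> fl fr; split=> [y|x]; [apply: fr | apply: fl]. Qed.

Lemma bilinear_tlift (f : U -> W -> X -> Y) :
  (forall z, bilinear_for *:%R *:%R (fun x y => f x y z)) ->
  (forall x y, linear (f x y)) ->
  bilinear_for *:%R *:%R (fun t z => tlift (fun x y => f x y z) t).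
Proof.
move=> fb fl; split=> [z|t] a u v /=; first exact: tlift_linear.
rewrite /tlift scaler_sumr -big_split /=.
by apply: eq_bigr => i _; rewrite fl.
Qed.

End BilinearMaps.

Arguments tens {F U W} x y.
Arguments tlift {F U W X} f t.
Arguments vcoord {F U} i.

Notation "x ⊗ y" := (tens x y) (at level 40, left associativity) : ring_scope.

(* The third tensor power is right-nested; [tassoc] is the associativity      *)
(* isomorphism.                                                               *)
Definition tensor3 (F : fieldType) (V : vectType F) : vectType F :=
  tensor V (tensor V V).

Section Permutations.
Variables (F : fieldType) (V : vectType F).

Definition tassoc (u : tensor (tensor V V) V) : tensor3 V :=
  tlift (fun xy z => tlift (fun x y => x ⊗ (y ⊗ z)) xy) u.

Definition tswap (u : tensor V V) : tensor V V := tlift (fun x y => y ⊗ x) u.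

Definition tswap12 (u : tensor3 V) : tensor3 V :=
  tlift (fun x yz => tlift (fun y z => y ⊗ (x ⊗ z)) yz) u.

Definition tswap23 (u : tensor3 V) : tensor3 V :=
  tlift (fun x yz => x ⊗ tswap yz) u.

Let tens_l (U W : vectType F) (y : W) : linear (fun x : U => x ⊗ y).
Proof. by case: (tens_bilinear U W) => + _; apply. Qed.

Let tens_r (U W : vectType F) (x : U) : linear (fun y : W => x ⊗ y).
Proof. by case: (tens_bilinear U W) => _; apply. Qed.

Lemma tassoc_bilinear :
  bilinear_for *:%R *:%R
    (fun (xy : tensor V V) (z : V) => tlift (fun x y => x ⊗ (y ⊗ z)) xy).
Proof.
apply: (@bilinear_tlift _ _ _ _ _ (fun x y z => x ⊗ (y ⊗ z))) => [z|x y a u v].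
  by apply: (bilinear_compr (tens_bilinear _ _)); apply: tens_l.
by rewrite tens_r; apply: tens_r.
Qed.

Lemma tassoc_linear : linear tassoc.
Proof. exact: (tlift_linear tassoc_bilinear). Qed.

Lemma tassocE x y z : tassoc (x ⊗ y ⊗ z) = x ⊗ (y ⊗ z).
Proof.
rewrite /tassoc (tliftE _ _ tassoc_bilinear) tliftE //.
by apply: (bilinear_compr (tens_bilinear _ _)); apply: tens_l.
Qed.

Lemma tswap_linear : linear tswap.
Proof. exact: (tlift_linear (bilinear_flip (tens_bilinear _ _))). Qed.

Lemma tswapE x y : tswap (x ⊗ y) = y ⊗ x.
Proof. exact: (tliftE _ _ (bilinear_flip (tens_bilinear _ _))). Qed.

Lemma tswap12_bilinear :
  bilinear_for *:%R *:%R
    (fun (x : V) (yz : tensor V V) => tlift (fun y z => y ⊗ (x ⊗ z)) yz).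
Proof.
apply: bilinear_flip.
apply: (@bilinear_tlift _ _ _ _ _ (fun y z x => y ⊗ (x ⊗ z))) => [x|y z a u v].
  by apply: (bilinear_compr (tens_bilinear _ _)); apply: tens_r.
by rewrite tens_l; apply: tens_r.
Qed.

Lemma tswap12_linear : linear tswap12.
Proof. exact: (tlift_linear tswap12_bilinear). Qed.

Lemma tswap12E x y z : tswap12 (x ⊗ (y ⊗ z)) = y ⊗ (x ⊗ z).
Proof.
rewrite /tswap12 (tliftE _ _ tswap12_bilinear) tliftE //.
by apply: (bilinear_compr (tens_bilinear _ _)); apply: tens_r.
Qed.

Let tswap23_bilinear :
  bilinear_for *:%R *:%R (fun (x : V) (yz : tensor V V) => x ⊗ tswap yz).
Proof. exact: (bilinear_compr (tens_bilinear _ _) tswap_linear). Qed.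

Lemma tswap23_linear : linear tswap23.
Proof. exact: (tlift_linear tswap23_bilinear). Qed.

Lemma tswap23E x y z : tswap23 (x ⊗ (y ⊗ z)) = x ⊗ (z ⊗ y).
Proof. by rewrite /tswap23 (tliftE _ _ tswap23_bilinear) tswapE. Qed.

End Permutations.

Section DoubleBracket.
Variables (F : fieldType) (V : vectType F).

Definition double_bracket := 'Hom(tensor V V, tensor V V).

Variable B : double_bracket.

Definition dbr (a b : V) : tensor V V := B (a ⊗ b).

(* {{a, b ⊗ c}}_L = {{a, b}} ⊗ c *)
Definition dbrL (a : V) (u : tensor V V) : tensor3 V :=
  tlift (fun b c => tassoc (dbr a b ⊗ c)) u.

(* {{a, b ⊗ c}}_R = b ⊗ {{a, c}} *)
Definition dbrR (a : V) (u : tensor V V) : tensor3 V :=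
  tlift (fun b c => b ⊗ dbr a c) u.

(* {{a ⊗ b, c}}_L = ({{a, c}} ⊗ b)^(23) *)
Definition dbrL' (u : tensor V V) (c : V) : tensor3 V :=
  tlift (fun a b => tswap23 (tassoc (dbr a c ⊗ b))) u.

Lemma dbr_bilinear : bilinear_for *:%R *:%R dbr.
Proof.
by apply: (bilinear_comp (tens_bilinear _ _)) => a u v; rewrite linearP.
Qed.

Let dbr_r a : linear (dbr a).
Proof. by case: dbr_bilinear => _; apply. Qed.

Let dbr_l b : linear (dbr^~ b).
Proof. by case: dbr_bilinear => + _; apply. Qed.

Let dbrL_bilinear a :
  bilinear_for *:%R *:%R (fun b c => tassoc (dbr a b ⊗ c)).
Proof.
apply: (bilinear_comp (f := fun b c => dbr a b ⊗ c) _ (@tassoc_linear _ _)).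
exact: (bilinear_compl (tens_bilinear _ _) (dbr_r a)).
Qed.

Lemma dbrL_linear a : linear (dbrL a).
Proof. by apply: tlift_linear; apply: dbrL_bilinear. Qed.

Lemma dbrLE a b c : dbrL a (b ⊗ c) = tassoc (dbr a b ⊗ c).
Proof. exact: (tliftE _ _ (dbrL_bilinear a)). Qed.

Let dbrR_bilinear a : bilinear_for *:%R *:%R (fun b c : V => b ⊗ dbr a c).
Proof. exact: (bilinear_compr (tens_bilinear _ _) (dbr_r a)). Qed.

Lemma dbrR_linear a : linear (dbrR a).
Proof. by apply: tlift_linear; apply: dbrR_bilinear. Qed.

Lemma dbrRE a b c : dbrR a (b ⊗ c) = b ⊗ dbr a c.
Proof. exact: (tliftE _ _ (dbrR_bilinear a)). Qed.

Let dbrL'_bilinear c :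
  bilinear_for *:%R *:%R (fun a b : V => tswap23 (tassoc (dbr a c ⊗ b))).
Proof.
apply: (bilinear_comp (f := fun a b => tassoc (dbr a c ⊗ b)) _
  (@tswap23_linear _ _)).
apply: (bilinear_comp (f := fun a b => dbr a c ⊗ b) _ (@tassoc_linear _ _)).
exact: (bilinear_compl (tens_bilinear _ _) (dbr_l c)).
Qed.

Lemma dbrL'_linear c : linear (dbrL'^~ c).
Proof. by apply: tlift_linear; apply: dbrL'_bilinear. Qed.

Lemma dbrL'E a b c : dbrL' (a ⊗ b) c = tswap23 (tassoc (dbr a c ⊗ b)).
Proof. exact: (tliftE _ _ (dbrL'_bilinear c)). Qed.

Definition double_lie (lambda : F) : Prop :=
  (forall a b : V,
     dbr a b + tswap (dbr b a) = lambda *: (a ⊗ b - b ⊗ a)) /\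
  (forall a b c : V,
     dbrL a (dbr b c) - dbrR b (dbr a c) - dbrL' (dbr a b) c
     = - (lambda *: tswap12 (b ⊗ dbr a c))).

End DoubleBracket.

(* [mul] is the product of the algebra: the ring structure that the library   *)
(* puts on 'End(V) requires V != 0 and multiplies in the opposite order.      *)
Definition rota_baxter (F : fieldType) (A : vectType F) (mul : A -> A -> A)
    (lambda : F) (R : 'End(A)) : Prop :=
  forall x y : A,
    mul (R x) (R y) = R (mul (R x) y + mul x (R y) + lambda *: mul x y).

Section TraceForm.
Variables (F : fieldType) (V : vectType F).

Definition lftrace (x : 'End(V)) : F :=
  \tr (passmx.mxof (vbasis {:V}) (vbasis {:V}) x).

Let b := vbasis {:V}.
Let b_basis : basis_of {:V} b := vbasisP _.

Lemma lftraceE (e : (\dim {:V}).-tuple V) x :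
  basis_of {:V} e -> lftrace x = \tr (passmx.mxof e e x).
Proof.
move=> eb.
rewrite -[x in RHS]comp_lfun1l -[x in RHS]comp_lfun1r.
rewrite (passmx.mxof_comp _ _ b_basis) (passmx.mxof_comp _ _ b_basis) mxtrace_mulC.
rewrite mulmxA -(passmx.mxof_comp _ _ eb) comp_lfun1l passmx.mxof1 ?mul1mx //.
exact: basis_free b_basis.
Qed.

Lemma lftrace_comp x y :
  lftrace (x \o y)%VF = \tr (passmx.mxof b b y *m passmx.mxof b b x).
Proof. by rewrite /lftrace (passmx.mxof_comp _ _ b_basis). Qed.

Lemma lftrace_is_linear : linear (lftrace : 'End(V) -> F^o).
Proof. by move=> a x y; rewrite /lftrace passmx.mxof_linear linearP. Qed.

Definition trace_dual n (e e' : n.-tuple 'End(V)) : Prop :=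
  forall i j : 'I_n, lftrace (tnth e i \o tnth e' j)%VF = (i == j)%:R.

Definition trace_adjoint (R Rs : 'End('End(V))) : Prop :=
  forall x y : 'End(V), lftrace (R x \o y)%VF = lftrace (x \o Rs y)%VF.

Lemma trace_adjoint_unique R Rs Rs' :
  trace_adjoint R Rs -> trace_adjoint R Rs' -> Rs = Rs'.
Proof.
move=> h h'; apply/lfunP => y.
apply: (can_inj (passmx.mxofK b_basis b_basis)); apply/matrixP=> i j.
have dE (M : 'M[F]_(\dim {:V})) : \tr (M *m delta_mx j i) = M i j.
  rewrite /mxtrace (bigD1 i) //= big1 ?addr0 => [|k ki].
    rewrite !mxE (bigD1 j) //= big1 ?addr0 => [|k kj]; rewrite !mxE ?eqxx ?mulr1 //.
    by rewrite (negbTE kj) mulr0.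
  by rewrite !mxE big1 // => l _; rewrite !mxE (negbTE ki) andbF mulr0.
have := h (passmx.hommx b b (delta_mx j i)) y; rewrite h' !lftrace_comp.
by rewrite passmx.hommxK // !dE.
Qed.

Lemma trace_adjoint_exists R : exists Rs, trace_adjoint R Rs.
Proof.
pose g (y : 'End(V)) : 'End(V) := passmx.hommx b b
  (\matrix_(i, j) lftrace (R (passmx.hommx b b (delta_mx j i)) \o y)%VF).
have g_lin : linear g.
  move=> a u v; apply: (can_inj (passmx.mxofK b_basis b_basis)).
  rewrite /g passmx.mxof_linear !passmx.hommxK //; apply/matrixP=> i j.
  by rewrite !mxE comp_lfunDr -comp_lfunZr lftrace_is_linear.
pose gM := GRing.isLinear.Build F _ _ _ g g_lin.
pose gL : {linear _ -> _} := HB.pack g gM.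
pose t y M : F^o := lftrace (R (passmx.hommx b b M) \o y)%VF.
have t_lin y : linear (t y).
  move=> a u v; rewrite /t.
  have -> : passmx.hommx b b (a *: u + v) =
      a *: passmx.hommx b b u + passmx.hommx b b v.
    apply: (can_inj (passmx.mxofK b_basis b_basis)).
    by rewrite passmx.mxof_linear !passmx.hommxK.
  by rewrite linearP comp_lfunDl -comp_lfunZl lftrace_is_linear.
exists (linfun gL) => x y; rewrite lfunE /= /g lftrace_comp passmx.hommxK //.
rewrite -[x in LHS](passmx.mxofK b_basis b_basis).
pose tM := GRing.isLinear.Build F _ _ _ (t y) (t_lin y).
pose tL : {linear 'M[F]_(\dim {:V}) -> F^o} := HB.pack (t y) tM.
rewrite -[LHS]/(tL _) [X in tL X]matrix_sum_delta linear_sum.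
under eq_bigr => i _ do rewrite linear_sum.
rewrite exchange_big; apply: eq_bigr => j _; rewrite mxE.
by apply: eq_bigr => i _; rewrite linearZ [X in _ = X * _]mxE; apply: mulrC.
Qed.

(* Rs is the adjoint of R: it exists and is unique by the two lemmas above.   *)
Definition skew_symmetric (lambda : F) (R : 'End('End(V))) : Prop :=
  exists2 Rs : 'End('End(V)), trace_adjoint R Rs &
    forall x : 'End(V),
      R x + Rs x + lambda *: x = (lambda * lftrace x) *: (\1%VF : 'End(V)).

End TraceForm.

(* Main.v *)
(* Reading a tensor as a map from functionals, the definition of the bracket  *)
(* says (f ⊗ 1){{a,b}} = R([a,f]) b, where [a,f] is the rank-one operator     *)
(* x |-> f(x) a; this does not involve the basis any more.  Put x = [a,f] and *)
(* y = [b,g].  Applying f ⊗ g to the first axiom gives                        *)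
(*   tr(R(x)y) + tr(xR(y)) = lambda (tr(x)tr(y) - tr(xy)),                    *)
(* which is skew-symmetry, as rank-one operators span End(V).  Applying       *)
(* f ⊗ g ⊗ 1 to the second axiom gives                                        *)
(*   R(yR(x)) - R(y)R(x) - R(R^*(y)x) = - lambda tr(y) R(x),                  *)
(* which becomes the Rota-Baxter identity once skew-symmetry is used to       *)
(* eliminate R^*.                                                             *)
From HB Require Import structures.
Require Import Defs.
From mathcomp Require Import all_boot all_order all_algebra.
Local Open Scope ring_scope.

Import GRing.Theory.

(** Contracting with functionals turns each axiom into an operator identity tested on rank-one
    operators. [dbr_eval] removes the basis, and [skew_axiomE] and [jacobi_axiomE] then translate
    the two axioms independently. The second translation needs only that R^* exists: contracting the
    second factor of {{a,b}} with g gives the vector R^*([b,g]) a. Given skew-symmetry, [theorem7]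
    substitutes R^*(y) = lambda tr(y) 1 - R(y) - lambda y. The trace terms cancel, and the
    Rota-Baxter identity for the pair (y, x) remains. *)

Lemma linear_lincomb (F : pzRingType) (U W : lmodType F) (l : U -> W) I
    (r : seq I) (P : pred I) (k : I -> F) (u : I -> U) :
  linear l ->
  l (\sum_(i <- r | P i) k i *: u i) = \sum_(i <- r | P i) k i *: l (u i).
Proof.
move=> l_lin; have l0 : l 0 = 0.
  by apply: (addrI (1 *: l 0)); rewrite -l_lin scaler0 !addr0 scale1r.
have lD : {morph l : x y / x + y}.
  by move=> x y; have := l_lin 1 x y; rewrite !scale1r.
rewrite (big_morph l lD l0); apply: eq_bigr => i _.
by have := l_lin (k i) (u i) 0; rewrite l0 !addr0.
Qed.

Arguments linear_lincomb {F U W l I r P k u} _.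

(** * Contractions of tensors with functionals *)

Section TensorEvaluation.
Context {F : fieldType} {V : vectType F}.
Implicit Types (f g h : 'Hom(V, F^o)) (a b c x y z : V).

(** Brings an evaluation to the basis sum by which [tlift] is defined, so that the evaluation lemmas
    below can be checked term by term. *)
Lemma tensor_coord (W : vectType F) (t : tensor V W) f :
  t f = \sum_(i < \dim {:V}) (f (vbasis {:V})`_i : F) *: t (vcoord i).
Proof.
by rewrite {1}[t]tensor_sum sum_lfunE; apply: eq_bigr => i _; rewrite tensE.
Qed.

Lemma functional_inj x y : (forall f, f x = f y) -> x = y.
Proof.
move=> fxy; rewrite (coord_vbasis (memvf x)) (coord_vbasis (memvf y)).
by apply: eq_bigr => i _; rewrite -!vcoordE fxy.
Qed.

Lemma tensor2P (t t' : tensor V V) :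
  (forall f g, g (t f) = g (t' f)) -> t = t'.
Proof. by move=> tt'; apply/lfunP => f; apply: functional_inj => g. Qed.

Lemma tensor3P (t t' : tensor3 V) :
  (forall f g, t f g = t' f g) -> t = t'.
Proof. by move=> tt'; apply/lfunP => f; apply/lfunP. Qed.

Lemma tswap_eval (t : tensor V V) f g : g (tswap t f) = f (t g).
Proof.
rewrite [t g]tensor_coord /tswap /tlift sum_lfunE !linear_sum.
by apply: eq_bigr => i _; rewrite tensE !linearZ; apply: mulrC.
Qed.

Lemma tassoc_eval (t : tensor V V) z f g :
  tassoc (t ⊗ z) f g = (g (t f) : F) *: z.
Proof.
rewrite /tassoc (tliftE _ _ (tassoc_bilinear V)) [t f]tensor_coord.
rewrite /tlift sum_lfunE sum_lfunE linear_sum scaler_suml.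
apply: eq_bigr => i _; rewrite tensE scale_lfunE tensE [in RHS]linearZ.
exact: scalerA.
Qed.

Lemma tswap12_eval b (t : tensor V V) f g :
  tswap12 (b ⊗ t) f g = (g b : F) *: t f.
Proof.
rewrite /tswap12 (tliftE _ _ (tswap12_bilinear V)) [t f]tensor_coord.
rewrite /tlift sum_lfunE sum_lfunE scaler_sumr.
by apply: eq_bigr => i _; rewrite tensE scale_lfunE tensE !scalerA mulrC.
Qed.

Lemma tswap23_eval (u : tensor3 V) f : tswap23 u f = tswap (u f).
Proof.
rewrite [u f]tensor_coord (linear_lincomb (@tswap_linear _ V)).
rewrite /tswap23 /tlift sum_lfunE.
by apply: eq_bigr => i _; rewrite tensE.
Qed.

Lemma tswap23_tassoc_eval (t : tensor V V) z f g :
  tswap23 (tassoc (t ⊗ z)) f g = (g z : F) *: t f.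
Proof.
apply: functional_inj => h; rewrite tswap23_eval tswap_eval tassoc_eval.
by rewrite !linearZ; apply: mulrC.
Qed.

Variable B : double_bracket V.

(** Contracting both factors of {{a,b}} leaves a functional h of b, and it is h that contracts the
    first factor of t. *)
Lemma dbrL_eval a (t : tensor V V) f g h :
  (forall b, h b = g (dbr B a b f)) -> dbrL B a t f g = t h.
Proof.
move=> hE; rewrite [t h]tensor_coord /dbrL /tlift !sum_lfunE.
by apply: eq_bigr => i _; rewrite tassoc_eval hE.
Qed.

Lemma dbrR_eval a (t : tensor V V) f g : dbrR B a t f g = dbr B a (t f) g.
Proof.
have [_ dbr_r] := dbr_bilinear B.
rewrite [t f]tensor_coord (linear_lincomb (dbr_r a)).
rewrite /dbrR /tlift !sum_lfunE.
by apply: eq_bigr => i _; rewrite tensE.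
Qed.

(* The hypothesis says that a = (1 ⊗ g)(t). *)
Lemma dbrL'_eval (t : tensor V V) c f g a :
  (forall h, h a = g (t h)) -> dbrL' B t c f g = dbr B a c f.
Proof.
move=> aE; have [dbr_l _] := dbr_bilinear B.
rewrite [a](coord_vbasis (memvf a)) (linear_lincomb (dbr_l c)).
rewrite /dbrL' /tlift !sum_lfunE.
apply: eq_bigr => i _; rewrite tswap23_tassoc_eval scale_lfunE.
by rewrite -vcoordE aE.
Qed.

End TensorEvaluation.

(** * Rank-one operators and the trace form *)

Section RankOne.
Context {F : fieldType} {V : vectType F}.
Implicit Types (f g : 'Hom(V, F^o)) (a b : V) (x y : 'End(V)).

Definition rank1 a f : 'End(V) := linfun (fun v => (f v : F) *: a).

Lemma rank1E a f v : rank1 a f v = (f v : F) *: a.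
Proof.
pose r v : V := (f v : F) *: a.
have r_lin : linear r by move=> k u w; rewrite /r linearP scalerDl scalerA.
pose rM := GRing.isLinear.Build F _ _ _ r r_lin.
pose rL : {linear V -> V} := HB.pack r rM.
by rewrite /rank1 (lfunE rL).
Qed.

Lemma comp_rank1 a f x : (rank1 a f \o x)%VF = rank1 a (f \o x)%VF.
Proof. by apply/lfunP => v; rewrite comp_lfunE !rank1E comp_lfunE. Qed.

Lemma rank1_comp a f x : (x \o rank1 a f)%VF = rank1 (x a) f.
Proof. by apply/lfunP => v; rewrite comp_lfunE !rank1E linearZ. Qed.

(** Inserting the decomposition of the identity along a basis b_i writes x as the sum of the
    [x(b_i), b_i^*]. *)
Lemma rank1_ind (P : 'End(V) -> Prop) :
  P 0 -> (forall x y, P x -> P y -> P (x + y)) ->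
  (forall a f, P (rank1 a f)) -> forall x, P x.
Proof.
move=> P0 PD P1 x.
have -> : x = \sum_(i < \dim {:V}) rank1 (x (vbasis {:V})`_i) (vcoord i).
  apply/lfunP => v; rewrite [v in LHS](coord_vbasis (memvf v)) linear_sum.
  by rewrite sum_lfunE; apply: eq_bigr => i _; rewrite rank1E vcoordE linearZ.
by apply: big_ind => // i _; apply: P1.
Qed.

Lemma lftrace_rank1 a f : lftrace (rank1 a f) = f a.
Proof.
rewrite /lftrace /mxtrace [a in RHS](coord_vbasis (memvf a)) linear_sum.
apply: eq_bigr => i _.
rewrite !mxE /= passmx.vecof_delta rank1E !linearZ; exact: mulrC.
Qed.

Lemma lftraceC x y : lftrace (x \o y)%VF = lftrace (y \o x)%VF.
Proof. by rewrite !lftrace_comp mxtrace_mulC. Qed.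

Lemma lftrace_comp_rank1 x a f : lftrace (x \o rank1 a f)%VF = f (x a).
Proof. by rewrite rank1_comp lftrace_rank1. Qed.

Lemma lftrace_nondegenerate x :
  (forall y, lftrace (y \o x)%VF = 0) -> x = 0.
Proof.
move=> x0; apply/lfunP => a; apply: functional_inj => f.
by rewrite -lftrace_comp_rank1 lftraceC x0 zero_lfunE linear0.
Qed.

Lemma lftraceD x y : lftrace (x + y) = lftrace x + lftrace y.
Proof. by have := lftrace_is_linear 1 x y; rewrite !scale1r. Qed.

Lemma lftrace0 : lftrace (0 : 'End(V)) = 0.
Proof. by apply: (addrI (lftrace (0 : 'End(V)))); rewrite -lftraceD !addr0. Qed.

Lemma lftraceZ k x : lftrace (k *: x) = k * lftrace x.
Proof. by have := lftrace_is_linear k x 0; rewrite lftrace0 !addr0. Qed.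

Lemma lftrace_sum I (r : seq I) (P : pred I) (E : I -> 'End(V)) :
  lftrace (\sum_(i <- r | P i) E i) = \sum_(i <- r | P i) lftrace (E i).
Proof. exact: (big_morph _ lftraceD lftrace0). Qed.

Lemma comp_lfun_suml I (r : seq I) (E : I -> 'End(V)) x :
  (\sum_(i <- r) E i \o x)%VF = \sum_(i <- r) (E i \o x)%VF.
Proof.
apply: (big_morph (fun y : 'End(V) => (y \o x)%VF)) => [y z|].
  exact: comp_lfunDl.
exact: comp_lfun0l.
Qed.

Lemma comp_lfun_sumr I (r : seq I) (E : I -> 'End(V)) x :
  (x \o \sum_(i <- r) E i)%VF = \sum_(i <- r) (x \o E i)%VF.
Proof.
by apply: big_morph => [y z|]; [apply: comp_lfunDr | apply: comp_lfun0r].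
Qed.

(** The difference of the two sides is trace-orthogonal to every e_i, hence to all of End(V), so it
    vanishes by nondegeneracy. *)
Lemma trace_dual_decomp n (e e' : n.-tuple 'End(V)) x :
    basis_of {:'End(V)} e -> trace_dual e e' ->
  x = \sum_(i < n) lftrace (tnth e i \o x)%VF *: tnth e' i.
Proof.
move=> e_basis ee'; apply/eqP; rewrite -subr_eq0; apply/eqP.
set d := x - _; have ed i : lftrace (tnth e i \o d)%VF = 0.
  rewrite /d comp_lfunDr comp_lfunNr -scaleN1r lftraceD lftraceZ mulN1r.
  rewrite comp_lfun_sumr lftrace_sum (bigD1 i) //= big1 => [|j ji].
    by rewrite addr0 -comp_lfunZr lftraceZ ee' eqxx mulr1 subrr.
  by rewrite -comp_lfunZr lftraceZ ee' eq_sym (negbTE ji) mulr0.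
apply: lftrace_nondegenerate => y.
rewrite (coord_basis e_basis (memvf y)) comp_lfun_suml lftrace_sum big1 // => i _.
by rewrite -comp_lfunZl lftraceZ -tnth_nth ed mulr0.
Qed.

End RankOne.

(** * Translation of the two axioms into identities for R *)

Section DoubleBracketOperator.
Context {F : fieldType} {V : vectType F}.
Variables (B : double_bracket V) (R : 'End('End(V))).
Implicit Types (f g : 'Hom(V, F^o)) (a b c : V) (x y : 'End(V)).

Lemma dbr_eval (n : nat) (e e' : n.-tuple 'End(V)) :
    basis_of {:'End(V)} e -> trace_dual e e' ->
    (forall a b, dbr B a b = \sum_(i < n) (tnth e i a ⊗ R (tnth e' i) b)) ->
  forall a b f, dbr B a b f = R (rank1 a f) b.
Proof.
move=> e_basis ee' BR a b f; rewrite BR sum_lfunE.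
rewrite [rank1 a f](trace_dual_decomp _ _ _ _ e_basis ee') linear_sum sum_lfunE.
apply: eq_bigr => i _.
by rewrite tensE lftrace_comp_rank1 linearZ scale_lfunE.
Qed.

Hypothesis BE : forall a b f, dbr B a b f = R (rank1 a f) b.

Lemma skew_axiomE (lambda : F) :
  (forall a b, dbr B a b + tswap (dbr B b a) = lambda *: (a ⊗ b - b ⊗ a)) <->
  skew_symmetric lambda R.
Proof.
(* This is f ⊗ g applied to the first axiom. It is also f applied to the value at a of the
   skew-symmetry identity for [b,g], with the term lambda [b,g] moved to the right. *)
pose skew a b f g := (g (R (rank1 a f) b) : F) + f (R (rank1 b g) a) =
  lambda * (f a * g b - f b * g a).
have adjE Rs a b f g : trace_adjoint R Rs ->
    f (Rs (rank1 b g) a) = g (R (rank1 a f) b).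
  by move=> Radj; rewrite -!lftrace_comp_rank1 Radj lftraceC.
apply: (@iff_trans _ (forall a b f g, skew a b f g)).
  have rhsE a b f g : g ((lambda *: (a ⊗ b - b ⊗ a)) f) =
      lambda * (f a * g b - f b * g a).
    by rewrite scale_lfunE add_lfunE opp_lfunE !tensE !(linearZ, linearB).
  split=> [skewB a b f g | skewR a b].
    have /(congr1 (fun t : tensor V V => g (t f) : F)) := skewB a b.
    by rewrite add_lfunE linearD /= tswap_eval !BE rhsE.
  apply: tensor2P => f g.
  by rewrite add_lfunE linearD /= tswap_eval !BE rhsE; apply: skewR.
have evalE Rs a b f g : trace_adjoint R Rs ->
    f ((R (rank1 b g) + Rs (rank1 b g) + lambda *: rank1 b g) a) =
    (g (R (rank1 a f) b) : F) + f (R (rank1 b g) a) + lambda * (g a * f b).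
  move=> Radj; rewrite !add_lfunE scale_lfunE rank1E !linearD /=.
  rewrite (adjE _ _ _ _ _ Radj) [X in X + _ = _]addrC; congr (_ + _).
  by rewrite scalerA linearZ; apply/esym/mulrA.
have idE a b f g :
    f (((lambda * lftrace (rank1 b g)) *: \1%VF : 'End(V)) a) = lambda * g b * f a.
  by rewrite scale_lfunE id_lfunE linearZ lftrace_rank1.
split=> [skewR | [Rs Radj skewRs] a b f g].
  have [Rs Radj] := trace_adjoint_exists R; exists Rs => //.
  apply: rank1_ind => [|x y Ex Ey|b g].
  - by rewrite !linear0 lftrace0 mulr0 scale0r !addr0.
  - rewrite lftraceD mulrDr scalerDl -Ex -Ey scalerDr !linearD /=.
    by rewrite [X in X + _ = _]addrACA [LHS]addrACA.
  apply/lfunP => a; apply: functional_inj => f.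
  rewrite (evalE _ _ _ _ _ Radj) idE (skewR a b f g) -mulrDr [g a * f b]mulrC.
  by rewrite subrK -mulrA [g b * f a]mulrC.
rewrite /skew; apply: (addIr (lambda * (g a * f b))).
rewrite -(evalE _ _ _ _ _ Radj) skewRs idE -mulrDr [g a * f b]mulrC subrK.
by rewrite -mulrA [g b * f a]mulrC.
Qed.

Lemma jacobi_axiomE (lambda : F) (Rs : 'End('End(V))) :
    trace_adjoint R Rs ->
  (forall a b c, dbrL B a (dbr B b c) - dbrR B b (dbr B a c)
      - dbrL' B (dbr B a b) c = - (lambda *: tswap12 (b ⊗ dbr B a c))) <->
  (forall x y, R (y \o R x)%VF - (R y \o R x)%VF - R (Rs y \o x)%VF =
      - (lambda * lftrace y) *: R x).
Proof.
move=> Radj.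
pose jac x y := R (y \o R x)%VF - (R y \o R x)%VF - R (Rs y \o x)%VF =
      - (lambda * lftrace y) *: R x.
have LE a b c f g : (dbrL B a (dbr B b c) - dbrR B b (dbr B a c)
      - dbrL' B (dbr B a b) c) f g =
    (R (rank1 b g \o R (rank1 a f))%VF - (R (rank1 b g) \o R (rank1 a f))%VF -
     R (Rs (rank1 b g) \o rank1 a f)%VF) c.
  rewrite !add_lfunE !opp_lfunE comp_lfunE comp_rank1 rank1_comp.
  (* By [BE], z |-> g({{a,z}} f) is g composed with R([a,f]). *)
  rewrite (dbrL_eval _ _ _ _ _ (g \o R (rank1 a f))%VF) => [|z]; last first.
    by rewrite comp_lfunE BE.
  rewrite dbrR_eval (dbrL'_eval _ _ _ _ _ (Rs (rank1 b g) a)) => [|h].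
    by rewrite !BE.
  (* Adjointness gives h(R^*([b,g]) a) = tr([a,h] R^*([b,g])) = tr(R([a,h]) [b,g]) = g(R([a,h])
     b). *)
  by rewrite BE -!lftrace_comp_rank1 Radj lftraceC.
have RE a b c f g : (- (lambda *: tswap12 (b ⊗ dbr B a c))) f g =
    (- (lambda * lftrace (rank1 b g)) *: R (rank1 a f)) c.
  rewrite !opp_lfunE !scale_lfunE tswap12_eval BE lftrace_rank1 scaleNr.
  by rewrite scalerA.
split=> [jacB | jacR a b c]; last first.
  by apply: tensor3P => f g; rewrite LE RE jacR.
(* Both sides of [jac] are additive in x and in y. *)
suff jac1 a f b g : jac (rank1 a f) (rank1 b g).
  move=> x y; rewrite -/(jac x y).
  elim/(@rank1_ind F V): x => [|x x' Ex Ex'|a f].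
  - by rewrite /jac !(linear0, comp_lfun0r, scaler0, subr0).
  - rewrite /jac !linearD /= !comp_lfunDr !linearD /= -Ex -Ex'.
    by rewrite [X in X + _ = _]addrACA [LHS]addrACA.
  elim/(@rank1_ind F V): y => [|y y' Ey Ey'|b g].
  - rewrite /jac !(linear0, comp_lfun0l, scaler0, subr0, lftrace0) /=.
    by rewrite mulr0 oppr0 scale0r.
  - rewrite /jac !linearD /= !comp_lfunDl !linearD /= lftraceD mulrDr opprD.
    rewrite scalerDl -Ey -Ey'.
    by rewrite [X in X + _ = _]addrACA [LHS]addrACA.
  exact: jac1.
by apply/lfunP => c; rewrite -LE -RE jacB.
Qed.

End DoubleBracketOperator.

Theorem theorem7 (F : fieldType) (V : vectType F) (lambda : F)
    (B : double_bracket V) (R : 'End('End(V)))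
    (N : nat) (e e' : N.-tuple 'End(V))
    (e_basis : basis_of {:'End(V)} e) (e_dual : trace_dual e e')
    (BR : forall a b : V,
        dbr B a b = \sum_(i < N) (tnth e i a ⊗ R (tnth e' i) b)) :
  double_lie B lambda <->
  skew_symmetric lambda R /\ rota_baxter (@comp_lfun F V V V) lambda R.
Proof.
have BE := dbr_eval B R N e e' e_basis e_dual BR.
have RBE Rs : trace_adjoint R Rs ->
    (forall x : 'End(V),
      R x + Rs x + lambda *: x = (lambda * lftrace x) *: \1%VF) ->
  (forall x y, R (y \o R x)%VF - (R y \o R x)%VF - R (Rs y \o x)%VF =
      - (lambda * lftrace y) *: R x) <-> rota_baxter (@comp_lfun F V V V) lambda R.
  move=> Radj skewRs.
  have RsE y : Rs y = (lambda * lftrace y) *: \1%VF - R y - lambda *: y.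
    by rewrite -skewRs [_ - R y]addrAC addrK addrAC subrr add0r.
  (* With the trace term moved to the left, the defect of the second axiom is exactly the
     Rota-Baxter defect at (y, x). *)
  have jacE x y : R (y \o R x)%VF - (R y \o R x)%VF - R (Rs y \o x)%VF
      + (lambda * lftrace y) *: R x =
      R ((R y \o x) + (y \o R x) + lambda *: (y \o x))%VF - (R y \o R x)%VF.
    rewrite RsE !comp_lfunDl !comp_lfunNl -!comp_lfunZl comp_lfun1l.
    rewrite !(linearD, linearN, linearZ) /= !opprK scalerN.
    rewrite -[- _ + _ + _]addrA [- _ + _]addrC addrA subrK addrACA.
    by rewrite [X in X + _ = _]addrC [- _ + _]addrC addrA.
  split=> [jacR x y | RB x y].
    by apply/esym/eqP; rewrite -subr_eq0 -jacE jacR scaleNr addNr.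
  by apply/eqP; rewrite -subr_eq0 scaleNr opprK jacE RB subrr.
split=> [[/(skew_axiomE B R BE) skewR jacB] | [skewR RB]].
  split=> //; case: skewR => Rs Radj skewRs.
  by apply/(RBE _ Radj skewRs)/(jacobi_axiomE B R BE _ _ Radj).
split; first exact/(skew_axiomE B R BE).
case: skewR => Rs Radj skewRs.
by apply/(jacobi_axiomE B R BE _ _ Radj)/(RBE _ Radj skewRs).
Qed.
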